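(* Let $T$ be a complete first-order theory. If $T$ is fully VC-minimal, then $T$ has low VC-density.
   Context: $\mathfrak{C}$ denotes a monster model of $T$. ''Formula'' means a formula without parameters; $x$ denotes a single variable, $\overline{x}, \overline{y}$ finite tuples of variables, $\mathrm{lg}(\overline{y})$ the length of $\overline{y}$; $\theta^1 = \theta$, $\theta^0 = \neg\theta$. Independence dimension $\le 1$: a family $\mathcal{A}$ of subsets of a set $X$ has independence dimension $\le 1$ with respect to $X$ if there are no two distinct $B_0, B_1 \in \mathcal{A}$ such that all four sets $B_0^{s} \cap B_1^{t}$ ($s,t \in \{0,1\}$) are nonempty, where $B^1 = B$ and $B^0 = X \setminus B$. Fully VC-minimal: $T$ is fully VC-minimal if there is a family of formulas $\Psi$, each of which has at least $x$ as a free variable (possibly as a dummy variable), such that: (i) the set $\mathcal{A}_\Psi = \{\psi(\mathfrak{C};\overline{b}) : \psi(x;\overline{y}) \in \Psi, \overline{b} \in \mathfrak{C}^{\mathrm{lg}(\overline{y})}\}$ has independence dimension $\le 1$ with respect to $\mathfrak{C}$; and (ii) for every formula $\varphi(x;\overline{y})$ there is a boolean combination $\psi(x;\overline{y})$ of formulas from $\Psi$ with variables $(x;\overline{y})$ such that $\varphi(x;\overline{y})$ is $T$-equivalent to $\psi(x;\overline{y})$. VC-density: for a partitioned formula $\varphi(\overline{x};\overline{y})$ and $B \subseteq \mathfrak{C}^{\mathrm{lg}(\overline{y})}$, $S_\varphi(B)$ is the set of all consistent sets of formulas of the form $\{\varphi(\overline{x};\overline{b})^{t(\overline{b})} : \overline{b}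 \in B\}$ with $t : B \to \{0,1\}$. The formula $\varphi(\overline{x};\overline{y})$ has VC-density $\le \ell$ if there is $K < \omega$ such that $|S_\varphi(B)| \le K \cdot |B|^\ell$ for all finite nonempty $B \subseteq \mathfrak{C}^{\mathrm{lg}(\overline{y})}$. $T$ has low VC-density if every formula $\varphi(\overline{x};\overline{y})$ has VC-density $\le \mathrm{lg}(\overline{x})$. *)

(* Defs.v *)
From mathcomp Require Import all_boot.
From mathcomp Require Import boolp classical_sets functions cardinality.

Set Implicit Arguments.
Unset Strict Implicit.
Unset Printing Implicit Defensive.

Local Open Scope classical_set_scope.
Local Open Scope card_scope.

Record language := Language {
  funsym : Type;
  relsym : Type;
  fun_arity : funsym -> nat;
  rel_arity : relsym -> nat }.

(* Well-scoped de Bruijn syntax: the free variables of a [term L n] or of a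
   [formula L n] are among v_0, ..., v_(n-1), any of which may be dummy.  [Ex]
   binds v_0 of its body and shifts the other variables by one. *)
Inductive term (L : language) (n : nat) : Type :=
| Var of 'I_n
| App (f : funsym L) of ('I_(fun_arity f) -> term L n).

Inductive formula (L : language) (n : nat) : Type :=
| Bot
| Equal of term L n & term L n
| Rel (r : relsym L) of ('I_(rel_arity r) -> term L n)
| Not of formula L n
| And of formula L n & formula L n
| Ex of formula L n.+1.

Arguments Bot {L n}.

(* A partitioned formula phi(x_0, ..., x_(n-1); y_0, ..., y_(m-1)) is an element
   of [formula L (n + m)]; [vcat a b] is the assignment x := a, y := b. *)
Definition vcat (T : Type) (n m : nat) (a : 'I_n -> T) (b : 'I_m -> T)
    (i : 'I_(n + m)) : T :=
  match fintype.split i with inl j => a j | inr k => b k end.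

Definition vcons (T : Type) (m : nat) (a : T) (b : 'I_m -> T) : 'I_m.+1 -> T :=
  @vcat T 1 m (fun=> a) b.

(* [up s] fixes v_0 and acts as [s] on the variables v_1, v_2, ... *)
Definition up (n k : nat) (s : 'I_n -> 'I_k) : 'I_n.+1 -> 'I_k.+1 :=
  vcons ord0 (fun i => lift ord0 (s i)).

Fixpoint rename_term (L : language) (n k : nat) (s : 'I_n -> 'I_k)
    (t : term L n) : term L k :=
  match t with
  | Var i => Var L (s i)
  | App f ts => App (fun i => rename_term s (ts i))
  end.

Fixpoint rename (L : language) (n k : nat) (s : 'I_n -> 'I_k)
    (phi : formula L n) : formula L k :=
  match phi with
  | Bot => Bot
  | Equal t u => Equal (rename_term s t) (rename_term s u)
  | Rel r ts => Rel (fun i => rename_term s (ts i))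
  | Not p => Not (rename s p)
  | And p q => And (rename s p) (rename s q)
  | Ex p => Ex (rename (up s) p)
  end.

Record structure (L : language) := Structure {
  carrier :> Type;
  carrier_inhabited : inhabited carrier;
  fun_interp : forall f : funsym L, ('I_(fun_arity f) -> carrier) -> carrier;
  rel_interp : forall r : relsym L, ('I_(rel_arity r) -> carrier) -> Prop }.

Fixpoint eval (L : language) (M : structure L) (n : nat) (v : 'I_n -> M)
    (t : term L n) : M :=
  match t with
  | Var i => v i
  | App f ts => fun_interp (fun i => eval v (ts i))
  end.

Fixpoint sat (L : language) (M : structure L) (n : nat) (phi : formula L n)
    (v : 'I_n -> M) : Prop :=
  match phi in formula _ _ return Prop with
  | Bot => False
  | Equal t u => eval v t = eval v u
  | Rel r ts => rel_interp (fun i => eval v (ts i))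
  | Not p => ~ sat p v
  | And p q => sat p v /\ sat q v
  | Ex p => exists a : M, sat p (vcons a v)
  end.

Definition theory (L : language) := set (formula L 0).

Definition models (L : language) (M : structure L) (T : theory L) : Prop :=
  forall s, T s -> forall v, sat (M := M) s v.

Definition entails (L : language) (T : theory L) (n : nat)
    (phi : formula L n) : Prop :=
  forall M : structure L, models M T -> forall v, sat (M := M) phi v.

Definition equivalent (L : language) (T : theory L) (n : nat)
    (phi psi : formula L n) : Prop :=
  forall M : structure L, models M T ->
    forall v, sat (M := M) phi v <-> sat (M := M) psi v.

Definition complete_theory (L : language) (T : theory L) : Prop :=
  (exists M : structure L, models M T) /\
  forall s : formula L 0, entails T s \/ entails T (Not s).

(* The L(M)-formula phi(x_0, ..., x_(n-1); b). *)
Record pformula (L : language) (M : structure L) (n : nat) := PFormula {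
  nparam : nat;
  body : formula L (n + nparam);
  params : 'I_nparam -> M }.

Arguments params {L M n} p _.

Definition elementary_embedding (L : language) (M N : structure L)
    (f : M -> N) : Prop :=
  forall (n : nat) (phi : formula L n) (v : 'I_n -> M),
    sat phi v <-> sat phi (f \o v).

Definition realizes (L : language) (M N : structure L) (f : M -> N) (n : nat)
    (p : set (pformula M n)) (a : 'I_n -> N) : Prop :=
  forall q, p q -> sat (body q) (vcat a (f \o params q)).

(* Consistency with the elementary diagram of M. *)
Definition consistent (L : language) (M : structure L) (n : nat)
    (p : set (pformula M n)) : Prop :=
  exists (N : structure L) (f : M -> N),
    elementary_embedding f /\ exists a, realizes f p a.

(* |A| < kappa, a cardinal being given by a type of that cardinality. *)
Definition smaller (U : Type) (A : set U) (kappa : Type) : Prop :=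
  ~ ([set: kappa] #<= A).

Definition saturated (L : language) (kappa : Type) (M : structure L) : Prop :=
  forall (A : set M), smaller A kappa ->
  forall p : set (pformula M 1),
    (forall q, p q -> forall i, A (params q i)) ->
    consistent p -> exists a, realizes id p a.

Definition automorphism (L : language) (M : structure L) (g : M -> M) : Prop :=
  [/\ bijective g,
      forall (f : funsym L) v, g (fun_interp v) = fun_interp (f := f) (g \o v) &
      forall (r : relsym L) v,
        rel_interp v <-> rel_interp (r := r) (g \o v)].

Definition partial_elementary (L : language) (M : structure L) (A : set M)
    (f : M -> M) : Prop :=
  forall (n : nat) (phi : formula L n) (v : 'I_n -> M),
    (forall i, A (v i)) -> sat phi v <-> sat phi (f \o v).

Definition strongly_homogeneous (L : language) (kappa : Type)
    (M : structure L) : Prop :=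
  forall (A : set M) (f : M -> M), smaller A kappa -> partial_elementary A f ->
    exists g, automorphism g /\ forall a, A a -> g a = f a.

(* The second clause says that kappa > |L| + aleph_0, the number of formulas. *)
Definition monster_model (L : language) (T : theory L) (kappa : Type)
    (C : structure L) : Prop :=
  [/\ models C T, smaller [set: {n : nat & formula L n}] kappa,
      saturated kappa C & strongly_homogeneous kappa C].

Definition signed_set (X : Type) (B : set X) (s : bool) : set X :=
  if s then B else ~` B.

Definition independence_dim_le1 (X : Type) (A : set (set X)) : Prop :=
  ~ exists B0 B1 : set X, [/\ A B0, A B1, B0 <> B1 &
      forall s t : bool, signed_set B0 s `&` signed_set B1 t !=set0].

(* A family of formulas psi(x; y_0, ..., y_(m-1)), where x is v_0. *)
Definition formula_family (L : language) := forall m : nat, set (formula L m.+1).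

Definition instances (L : language) (C : structure L)
    (Psi : formula_family L) : set (set C) :=
  [set D | exists (m : nat) (psi : formula L m.+1) (b : 'I_m -> C),
     Psi m psi /\ D = [set a | sat psi (vcons a b)]].

Arguments instances {L} C Psi.

(* Boolean combinations psi(x; y_0, ..., y_(m-1)) of formulas from Psi.  Since
   the variables of a formula carry no names, a member of Psi with k variables
   besides x may be used with any of y_0, ..., y_(m-1) in their places. *)
Inductive boolean_combination (L : language) (Psi : formula_family L)
    (m : nat) : formula L m.+1 -> Prop :=
| BC_mem k (psi : formula L k.+1) (s : 'I_k -> 'I_m) :
    Psi k psi -> boolean_combination Psi (rename (up s) psi)
| BC_bot : boolean_combination Psi Bot
| BC_not p : boolean_combination Psi p -> boolean_combination Psi (Not p)
| BC_and p q : boolean_combination Psi p -> boolean_combination Psi q ->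
    boolean_combination Psi (And p q).

Definition fully_vc_minimal (L : language) (T : theory L)
    (C : structure L) : Prop :=
  exists Psi : formula_family L,
    independence_dim_le1 (instances C Psi) /\
    forall (m : nat) (phi : formula L m.+1),
      exists psi, boolean_combination Psi psi /\ equivalent T phi psi.

Definition signed_formula (L : language) (n : nat) (phi : formula L n)
    (s : bool) : formula L n :=
  if s then phi else Not phi.

Definition phi_types (L : language) (C : structure L) (n m : nat)
    (phi : formula L (n + m)) (B : set ('I_m -> C)) : set (set (pformula C n)) :=
  [set p | (exists t : ('I_m -> C) -> bool,
              p = [set PFormula (signed_formula phi (t b)) b | b in B])
           /\ consistent p].

Definition vc_density_le (L : language) (C : structure L) (n m : nat)
    (phi : formula L (n + m)) (l : nat) : Prop :=
  exists K : nat, forall (k : nat) (B : set ('I_m -> C)),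
    B !=set0 -> B #= `I_k -> phi_types phi B #<= `I_(K * k ^ l).

Definition low_vc_density (L : language) (C : structure L) : Prop :=
  forall (n m : nat) (phi : formula L (n + m)), vc_density_le C phi n.

(* Main.v *)
(* Eliminate the variables x_0, ..., x_(n-1) one at a time.  Replacing each
   instance of Psi by its complement when it contains a fixed point p turns the
   instances into a family of sets any two of which are nested or disjoint.
   Over a finite set B, the type of x_0 is therefore determined by the least
   such set containing x_0, hence by a single b in B: "x_0 is in S" means "that
   least set is included in S", a formula in b, p and the parameters of S (if
   no set contains x_0, then x_0 has the same type as p).  As full VC-minimality
   allows these parameters to involve x_1, ..., x_(n-1), the relation phi(x; y)
   becomes one of finitely many formulas theta(x_1, ..., x_(n-1); y, b, p).
   After n steps the phi-type of x over B is given by one of finitely many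
   formulas and n elements of B. *)

From mathcomp Require Import all_boot.
From mathcomp Require Import boolp classical_sets functions cardinality.
Require Import Defs.

Set Implicit Arguments.
Unset Strict Implicit.
Unset Printing Implicit Defensive.

Local Open Scope classical_set_scope.
Local Open Scope card_scope.

(** * Assignments extended by one value *)

Lemma vconsE (T : Type) (m : nat) (a : T) (b : 'I_m -> T) :
  vcons a b = fun i => oapp b a (unlift ord0 i).
Proof.
apply/funext => i; rewrite /vcons /vcat.
case: splitP => [j|j] ij; case: unliftP => [l|] il //=.
- by move: ij; rewrite il lift0; case: j => -[].
- by congr b; apply/val_inj; move: ij; rewrite il lift0 => -[].
- by move: ij; rewrite il.
Qed.

Lemma vcons_eta (T : Type) (m : nat) (a : 'I_m.+1 -> T) :
  vcons (a ord0) (a \o lift ord0) = a.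
Proof. by rewrite vconsE; apply/funext => i; case: unliftP => [j|] ->. Qed.

Lemma vcons_ord0 (T : Type) (m : nat) (a : T) (b : 'I_m -> T) :
  vcons a b ord0 = a.
Proof. by rewrite vconsE unlift_none. Qed.

Lemma vcons_lift (T : Type) (m : nat) (a : T) (b : 'I_m -> T) i :
  vcons a b (lift ord0 i) = b i.
Proof. by rewrite vconsE liftK. Qed.

Lemma vcons_up (T : Type) (n k : nat) (s : 'I_n -> 'I_k) (a : T) v :
  vcons a v \o up s = vcons a (v \o s).
Proof.
apply/funext => i; rewrite /up !vconsE /=.
by case: (unliftP ord0 i) => [j|] _ /=; rewrite ?liftK ?unlift_none.
Qed.

(** * Relations defined by one formula uniformly in all structures *)

Section Definability.
Variable L : language.
Implicit Types M N : structure L.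

Lemma eval_rename M n k (s : 'I_n -> 'I_k) (t : term L n) (v : 'I_k -> M) :
  eval v (rename_term s t) = eval (v \o s) t.
Proof.
elim: t => //= f ts ih; congr (fun_interp _).
by apply/funext => i; apply: ih.
Qed.

Lemma sat_rename M n (phi : formula L n) k (s : 'I_n -> 'I_k) (v : 'I_k -> M) :
  sat (rename s phi) v <-> sat phi (v \o s).
Proof.
elim: phi k s v => //= {n}.
- by move=> n t u k s v; rewrite !eval_rename.
- move=> n r ts k s v; set u := (X in rel_interp X <-> _).
  suff -> : u = fun i => eval (v \o s) (ts i) by [].
  by apply/funext => i; apply: eval_rename.
- by move=> n p ih k s v; rewrite ih.
- by move=> n p ihp q ihq k s v; rewrite ihp ihq.
- by move=> n p ih k s v; split=> -[a pa]; exists a; move: pa;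
    rewrite ih vcons_up.
Qed.

(* Variables are named by the elements of an arbitrary type [I]. *)
Definition definable (I : Type) (D : forall M, (I -> M) -> Prop) : Prop :=
  exists n (phi : formula L n) (s : 'I_n -> I),
    forall M (v : I -> M), D M v <-> sat phi (v \o s).

Lemma definable_ext (I : Type) (D E : forall M, (I -> M) -> Prop) :
  (forall M v, D M v <-> E M v) -> definable E -> definable D.
Proof.
move=> DE [n [phi [s Es]]]; exists n, phi, s => M v.
by rewrite DE Es.
Qed.

Lemma definable_sat n (phi : formula L n) :
  definable (fun M (v : 'I_n -> M) => sat phi v).
Proof. by exists n, phi, id. Qed.

Lemma definable_reindex (I J : Type) (s : I -> J)
    (D : forall M, (I -> M) -> Prop) :
  definable D -> definable (fun M v => D M (v \o s)).
Proof. by move=> [n [phi [r Dr]]]; exists n, phi, (s \o r) => M v; apply: Dr. Qed.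

(** The distinguished argument is kept apart so that a relation of a point and a tuple, such as an
    atom, can be evaluated at any chosen variable [j]. *)
Lemma definable_reindex1 (I J : Type) (j : J) (s : I -> J)
    (D : forall M, M -> (I -> M) -> Prop) :
  definable (fun M (v : option I -> M) => D M (v None) (v \o Some)) ->
  definable (fun M (v : J -> M) => D M (v j) (v \o s)).
Proof. by move/(definable_reindex (oapp s j)). Qed.

Lemma definable_not (I : Type) (D : forall M, (I -> M) -> Prop) :
  definable D -> definable (fun M v => ~ D M v).
Proof. by move=> [n [phi [s Ds]]]; exists n, (Not phi), s => M v /=; rewrite Ds. Qed.

Lemma definable_and (I : Type) (D E : forall M, (I -> M) -> Prop) :
  definable D -> definable E -> definable (fun M v => D M v /\ E M v).
Proof.
move=> [n [phi [s Ds]]] [m [psi [r Er]]].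
exists (n + m), (And (rename (lshift m) phi) (rename (@rshift n m) psi)), (vcat s r).
move=> M v /=; rewrite !sat_rename Ds Er.
suff [-> ->] : v \o vcat s r \o lshift m = v \o s /\
               v \o vcat s r \o @rshift n m = v \o r by [].
split; apply/funext => i /=; rewrite /vcat.
  by rewrite -[lshift m i]/(unsplit (inl i)) unsplitK.
by rewrite -[rshift n i]/(unsplit (inr i)) unsplitK.
Qed.

Lemma definable_false (I : Type) : definable (fun M (_ : I -> M) => False).
Proof.
have no : 'I_0 -> I by case.
by exists 0, Bot, no.
Qed.

Lemma definable_iff (I : Type) (D E : forall M, (I -> M) -> Prop) :
  definable D -> definable E -> definable (fun M v => D M v <-> E M v).
Proof.
move=> dD dE.
apply: (definable_ext (E := fun M v => ~ (D M v /\ ~ E M v) /\ ~ (E M v /\ ~ D M v))).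
  by move=> M v; case: (EM (D M v)); case: (EM (E M v)); tauto.
by do !(apply: definable_and || apply: definable_not || assumption).
Qed.

Lemma definable_imp (I : Type) (D E : forall M, (I -> M) -> Prop) :
  definable D -> definable E -> definable (fun M v => D M v -> E M v).
Proof.
move=> dD dE.
apply: (definable_ext (E := fun M v => ~ (D M v /\ ~ E M v))).
  by move=> M v; case: (EM (D M v)); case: (EM (E M v)); tauto.
by do !(apply: definable_and || apply: definable_not || assumption).
Qed.

Lemma definable_all (I : Type) (K : finType)
    (D : K -> forall M, (I -> M) -> Prop) :
  (forall k, definable (D k)) -> definable (fun M v => forall k, D k M v).
Proof.
move=> dD.
apply: (definable_ext (E := fun M v => forall k, k \in enum K -> D k M v)).
  by move=> M v; split=> [h k _|h k]; [exact: h|apply: h; rewrite mem_enum].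
elim: (enum K) => [|k r ih].
  apply: (definable_ext _ (definable_not (definable_false I))) => M v.
  by split=> [_ []|_ k].
apply: (definable_ext _ (definable_and (dD k) ih)) => M v; split.
  by move=> h; split=> [|l lr]; apply: h; rewrite inE ?eqxx ?lr ?orbT.
by move=> [hk hr] l; rewrite inE => /predU1P[->//|/hr].
Qed.

(** Both full VC-minimality and [Ex] single out [v_0]; the distinguished variable [None] is moved
    there. *)
Lemma definable_option (I : Type) (D : forall M, (option I -> M) -> Prop) :
  definable D -> exists m (phi : formula L m.+1) (s : 'I_m -> I),
    forall M v, D M v <-> sat phi (vcons (v None) (v \o Some \o s)).
Proof.
move=> [n [phi [s Ds]]]; case: (pselect (inhabited I)) => [[x]|I0].
(* Variables that [s] names [None] are redirected to [v_0]; the places they leave vacant among the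
   other variables are filled with the dummy [x]. *)
- exists n, (rename (fun i => if s i then lift ord0 i else ord0) phi),
    (fun i => odflt x (s i)).
  move=> M v; rewrite sat_rename Ds; set u := (X in sat phi X <-> _).
  set w := (X in _ <-> sat phi X); suff -> : u = w by [].
  apply/funext => i; rewrite /u /w vconsE /=.
  by case si: (s i) => [y|]; rewrite ?liftK ?unlift_none /= ?si.
(* With [I] empty there is no dummy, but then every variable of [phi] is named [None]. *)
- have sN i : s i = None by case: (s i) => // y; case: I0.
  have no : 'I_0 -> I by case.
  exists 0, (rename (fun=> ord0) phi), no.
  move=> M v; rewrite sat_rename Ds; set u := (X in sat phi X <-> _).
  set w := (X in _ <-> sat phi X); suff -> : u = w by [].
  by apply/funext => i; rewrite /u /w vconsE /= unlift_none sN.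
Qed.

Lemma definable_ex (I : Type) (D : forall M, M -> (I -> M) -> Prop) :
  definable (fun M (v : option I -> M) => D M (v None) (v \o Some)) ->
  definable (fun M v => exists x, D M x v).
Proof.
move=> /definable_option[m [phi [s Ds]]]; exists m, (Ex phi), s => M v /=.
by split=> -[x]; have /= := Ds M (oapp v x) => H; [move/H|move/H]; exists x.
Qed.

Lemma definable_forall (I : Type) (D : forall M, M -> (I -> M) -> Prop) :
  definable (fun M (v : option I -> M) => D M (v None) (v \o Some)) ->
  definable (fun M v => forall x, D M x v).
Proof.
move=> /definable_not/(@definable_ex _ (fun M x v => ~ D M x v)) h.
apply: (definable_ext _ (definable_not h)) => M v.
by split=> [a [x /(_ (a x))]|a x] //; apply: contrapT => n; apply: a; exists x.
Qed.

Lemma definable_ex_tuple (n : nat) (I : Type)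
    (D : forall M, ('I_n -> M) -> (I -> M) -> Prop) :
  definable (fun M (v : 'I_n + I -> M) => D M (v \o inl) (v \o inr)) ->
  definable (fun M v => exists a, D M a v).
Proof.
elim: n I D => [|n ih] I D dD.
  have noI : 'I_0 -> I by case.
  apply: (definable_ext _ (definable_reindex
    (fun t => match t with inl i => noI i | inr j => j end) dD)) => M v.
  have E a : a = v \o noI by apply/funext => -[].
  by split=> [[a]|]; [rewrite (E a)|exists (v \o noI)].
apply: (definable_ext (E := fun M v => exists x, exists a, D M (vcons x a) v)).
  move=> M v; split=> [[a]|[x [a h]]]; last by exists (vcons x a).
  by rewrite -(vcons_eta a); exists (a ord0), (a \o lift ord0).
apply: (definable_ex (D := fun M x v => exists a, D M (vcons x a) v)).
apply: (ih _ (fun M a v => D M (vcons (v None) a) (v \o Some))).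
(* Entry 0 of the tuple becomes the outer variable [None]; the other entries shift down by one. *)
apply: (definable_ext _ (definable_reindex (fun t : 'I_n.+1 + I => match t with
  | inl i => oapp inl (inr None) (unlift ord0 i)
  | inr j => inr (Some j) end) dD)) => M v /=.
set u := vcons _ _; set w := (X in _ <-> D M X _); suff -> : u = w by [].
by apply/funext => i; rewrite /u /w vconsE /=; case: unlift.
Qed.

Lemma definable_elementary M N (f : M -> N) (I : Type)
    (D : forall M, (I -> M) -> Prop) (v : I -> M) :
  elementary_embedding f -> definable D -> D N (f \o v) -> D M v.
Proof. by move=> fP [n [phi [s Ds]]] /Ds /(fP _ phi (v \o s)) /Ds. Qed.

End Definability.

(** * Families of independence dimension at most 1 *)

(** The set of x with [~ (B x <-> B p)] is [B] or its complement, whichever omits [p]. If two such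
    sets contain [a] and neither includes the other, take [x] and [y] in their two differences: then
    [p], [x], [y], [a] lie one in each of the four cells, and complementing [B0] or [B1] only
    permutes the cells. *)
Lemma independence_dim_le1_chain (X : Type) (A : set (set X)) (B0 B1 : set X)
    (p a : X) :
  independence_dim_le1 A -> A B0 -> A B1 ->
  ~ (B0 a <-> B0 p) -> ~ (B1 a <-> B1 p) ->
  (forall x, ~ (B0 x <-> B0 p) -> ~ (B1 x <-> B1 p)) \/
  (forall x, ~ (B1 x <-> B1 p) -> ~ (B0 x <-> B0 p)).
Proof.
move=> hA A0 A1 a0 a1; apply: contrapT => /not_orP[].
move=> /existsNP[x /not_implyP[x0 x1]] /existsNP[y /not_implyP[y1 y0]].
apply: hA; exists B0, B1; split=> //; first by move=> B01; rewrite B01 in x0.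
have neg P Q : ~ (P <-> Q) -> P = ~ Q.
  by move=> PQ; apply/propext; case: (EM P); case: (EM Q); tauto.
move: x1 y0 a0 a1 x0 y1 => /contrapT/propext x1 /contrapT/propext y0.
move=> /neg a0 /neg a1 /neg x0 /neg y1 s t.
have sgn B r z : B z = (if `[< B p >] == r then B p else ~ B p) ->
    signed_set B r z.
  by rewrite /signed_set; case: asboolP; case: r => /= Bp e; rewrite /setC /mkset e //.
suff [z [z0 z1]] : exists z,
    B0 z = (if `[< B0 p >] == s then B0 p else ~ B0 p) /\
    B1 z = (if `[< B1 p >] == t then B1 p else ~ B1 p).
  by exists z; split; apply: sgn.
by case: eqP => _; case: eqP => _; [exists p|exists y|exists x|exists a].
Qed.

Lemma chain_min (X : Type) (K : eqType) (S : K -> set X) (a : X) (l : seq K) :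
  (forall k k', S k a -> S k' a -> S k `<=` S k' \/ S k' `<=` S k) ->
  (forall k, k \in l -> ~ S k a) \/
  (exists2 k, S k a & forall k', k' \in l -> S k' a -> S k `<=` S k').
Proof.
move=> chain; elim: l => [|k l ih]; first by left.
have [ka|nka] := EM (S k a); last first.
  case: ih => [h|[k0 k0a h]]; [left|right; exists k0 => //];
    by move=> k'; rewrite inE => /predU1P[->//|/h].
right; case: ih => [h|[k0 k0a h]].
  by exists k => // k'; rewrite inE => /predU1P[-> _ x|/h].
have [kk0|k0k] := chain _ _ ka k0a.
  exists k => // k'; rewrite inE => /predU1P[-> _ x|k'l k'a] //.
  exact: (subset_trans kk0 (h _ k'l k'a)).
by exists k0 => // k'; rewrite inE => /predU1P[->|/h].
Qed.

(** * Elimination of variables under full VC-minimality *)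

Section FullyVCMinimal.
Variables (L : language) (C : structure L).

(** Separates the atoms from a truth function [beta]. The third clause lets [beta] act on arbitrary
    definable relations, because the atoms will be replaced under it by statements about
    inclusions. *)
Lemma boolean_combination_atoms (Psi : formula_family L) m (psi : formula L m.+1) :
  boolean_combination Psi psi ->
  exists (K : finType) (A : K -> forall M : structure L, M -> ('I_m -> M) -> Prop)
         (beta : (K -> Prop) -> Prop),
  [/\ forall k, definable (fun M (v : option 'I_m -> M) => A k M (v None) (v \o Some)),
      forall k b, instances C Psi [set x | A k C x b],
      forall (I : Type) (E : K -> forall M : structure L, (I -> M) -> Prop),
        (forall k, definable (E k)) ->
        definable (fun M v => beta (fun k => E k M v)) &
      forall (M : structure L) (x : M) b,
        sat psi (vcons x b) <-> beta (fun k => A k M x b)].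
Proof.
elim=> {psi} [k psi s Psi_psi| |p _ [K [A [be [dA iA dbe pbe]]]]
  |p q _ [K [A [be [dA iA dbe pbe]]]] _ [K' [A' [be' [dA' iA' dbe' qbe]]]]].
- exists unit, (fun _ M x b => sat psi (vcons x (b \o s))), (fun P => P tt).
  split=> // [_|_ b|M x b]; last by rewrite sat_rename vcons_up.
  + apply: (definable_ext _ (definable_reindex
      (fun i => oapp (Some \o s) None (unlift ord0 i)) (definable_sat psi))).
    move=> M v; set u := vcons _ _; set w := (X in _ <-> sat psi X).
    suff -> : u = w by [].
    by rewrite /u /w vconsE; apply/funext => i /=; case: unlift.
  + by exists k, psi, (b \o s).
- exists void, (fun=> fun _ _ _ => False), (fun=> False).
  by split=> [[]|[]|I E _|M x b] //; apply: definable_false.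
- exists K, A, (fun P => ~ be P); split=> // [I E dE|M x b].
    by apply: definable_not; apply: dbe.
  by rewrite /= pbe.
- exists (K + K')%type, (fun k => match k with inl k => A k | inr k => A' k end).
  exists (fun P => be (P \o inl) /\ be' (P \o inr)); split.
  + by case.
  + by case.
  + move=> I E dE.
    by apply: definable_and; [apply: (dbe _ (E \o inl))|apply: (dbe' _ (E \o inr))]
      => k; apply: dE.
  + by move=> M x b /=; rewrite pbe qbe.
Qed.

Variable T : theory L.
Hypothesis CT : models C T.
Hypothesis minC : fully_vc_minimal T C.

(** The first copy of [W] holds the parameters at which [D] is tested, the second those of the least
    set around [a]; [None] holds the base point [p]. *)
Lemma one_variable_types (W : Type) (D : forall M : structure L, M -> (W -> M) -> Prop) :
  definable (fun M (v : option W -> M) => D M (v None) (v \o Some)) ->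
  exists (J : finType)
         (theta : J -> forall M : structure L, (W -> M) -> (W -> M) -> M -> Prop),
    (forall j, definable (fun M (v : option (W + W) -> M) =>
       theta j M (v \o Some \o inl) (v \o Some \o inr) (v None))) /\
    forall (p : C) (F : finType) (f0 : F) (w : F -> W -> C) (a : C),
      exists j f, forall f', D C a (w f') <-> theta j C (w f') (w f) p.
Proof.
move=> dD; have [m [phi [s Ds]]] := definable_option dD.
have [Psi [ind vcmin]] := minC.
have [psi [/boolean_combination_atoms[K [A [be [dA iA dbe psibe]]]] phipsi]] := vcmin _ phi.
have DE (x : C) w : D C x w <-> be (fun k => A k C x (w \o s)).
  have /= := Ds C (oapp w x); rewrite (phipsi C CT) psibe; exact.
(* The instance of atom [k] at [w], complemented when it contains [p]. *)
pose S k (M : structure L) (w : W -> M) p x :=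
  ~ (A k M x (w \o s) <-> A k M p (w \o s)).
(* Index [None] is for the case where no set contains [a]; index [Some k0] says which atom yields
   the least set. Undoing the complementation, atom [k] holds at [a] iff exactly one of these is
   true: [a] lies in the set of [k], or atom [k] holds at [p]. Hence the negated equivalence, with
   inclusion of the least set standing for membership of [a]. *)
exists (option K), (fun o M w w0 p => match o with
  | None => D M p w
  | Some k0 => be (fun k => ~ ((forall x, S k0 M w0 p x -> S k M w p x) <->
                              A k M p (w \o s)))
  end); split.
  case=> [k0|]; last exact: (definable_reindex1 None (Some \o inl) dD).
  apply: (dbe _ (fun k M v => ~ ((forall x, S k0 M (v \o Some \o inr) (v None) x ->
    S k M (v \o Some \o inl) (v None) x) <-> A k M (v None) (v \o Some \o inl \o s)))).
  move=> k; apply: definable_not; apply: definable_iff; last first.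
    exact: (definable_reindex1 None (Some \o inl \o s) (dA k)).
  apply: (definable_forall (D := fun M x v => S k0 M (v \o Some \o inr) (v None) x ->
    S k M (v \o Some \o inl) (v None) x)).
  apply: definable_imp; apply: definable_not; apply: definable_iff.
  - exact: (definable_reindex1 None (Some \o Some \o inr \o s) (dA k0)).
  - exact: (definable_reindex1 (Some None) (Some \o Some \o inr \o s) (dA k0)).
  - exact: (definable_reindex1 None (Some \o Some \o inl \o s) (dA k)).
  - exact: (definable_reindex1 (Some None) (Some \o Some \o inl \o s) (dA k)).
move=> p F f0 w a.
(* The minimum is taken over all atoms and all parameter tuples at once, so a single choice serves
   every [f']. *)
have := @chain_min C (K * F)%type (fun kf => S kf.1 C (w kf.2) p) a (enum {: K * F}).
case.
- move=> [k f] [k' f'] /= ka k'a.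
  exact: (independence_dim_le1_chain ind (iA k (w f \o s)) (iA k' (w f' \o s)) ka k'a).
- move=> h; exists None, f0 => f; rewrite !DE.
  suff -> : (fun k => A k C a (w f \o s)) = (fun k => A k C p (w f \o s)) by [].
  apply/funext => k; apply/propext; apply: contrapT.
  by apply: (h (k, f)); rewrite mem_enum.
- move=> [[k0 f1] k0a h]; exists (Some k0), f1 => f; rewrite DE.
  set P := (fun k => A k C a _); set Q := (X in _ <-> be X).
  suff -> : P = Q by [].
  apply/funext => k; apply/propext; rewrite /P /Q.
  (* Inclusion gives membership because the least set contains [a]; minimality gives the
     converse. *)
  have -> : (forall x, S k0 C (w f1) p x -> S k C (w f) p x) <-> S k C (w f) p a.
    by split=> [/(_ a k0a)//|ka]; apply: (h (k, f)) => //; rewrite mem_enum.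
  rewrite /S; case: (EM (A k C a (w f \o s))); case: (EM (A k C p (w f \o s))); tauto.
Qed.

(** The three pieces are the x-variables still to be eliminated, the variables ranging over the
    finite set, and the parameters held fixed. *)
Definition glue (X Y Z U : Type) (a : X -> U) (b : Y -> U) (c : Z -> U)
    (t : X + (Y + Z)) : U :=
  match t with inl x => a x | inr (inl y) => b y | inr (inr z) => c z end.

(** Induction on [n] with [Z] arbitrary, since fixed parameters accumulate: eliminating the first
    variable adds the point [p] and the tuple [b f1] selected for it, so the induction hypothesis is
    used at [option (Y + Z)]. *)
Lemma tuple_types (n : nat) (Y Z : Type)
    (R : forall M : structure L, ('I_n -> M) -> (Y -> M) -> (Z -> M) -> Prop) :
  definable (fun M (v : 'I_n + (Y + Z) -> M) =>
    R M (v \o inl) (v \o inr \o inl) (v \o inr \o inr)) ->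
  exists (J : finType)
         (theta : J -> (Y -> C) -> ('I_n -> Y -> C) -> (Z -> C) -> Prop),
    forall (F : finType) (f0 : F) (b : F -> Y -> C) a c,
      exists j (u : 'I_n -> F), forall f,
        R C a (b f) c <-> theta j (b f) (b \o u) c.
Proof.
elim: n Y Z R => [|n ih] Y Z R dR.
  have no (U : Type) : 'I_0 -> U by case.
  exists unit, (fun _ y _ z => R C (no C) y z) => F f0 b a c.
  exists tt, (no F) => f; suff -> : a = no C by [].
  by apply/funext => -[].
pose D M x w := R M (vcons x (w \o inl)) (w \o inr \o inl) (w \o inr \o inr).
have [|J1 [th1 [dth1 th1P]]] := @one_variable_types ('I_n + (Y + Z)) D.
  apply: (definable_ext _ (definable_reindex (fun t : 'I_n.+1 + (Y + Z) =>
    match t with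
    | inl i => oapp (Some \o inl) None (unlift ord0 i)
    | inr r => Some (inr r)
    end) dR)) => M v; rewrite /D.
  set u := vcons _ _; set w := (X in _ <-> R M X _ _); suff -> : u = w by [].
  by apply/funext => i; rewrite /u /w vconsE /=; case: unlift.
(* The remaining x-variables are common to the tested and the selected parameters, so they enter
   both tuple arguments of [th1 j]. *)
have dR1 j : definable (fun M (v : 'I_n + (Y + option (Y + Z)) -> M) =>
    th1 j M (glue (v \o inl) (v \o inr \o inl) (v \o inr \o inr \o Some \o inr))
      (glue (v \o inl) (v \o inr \o inr \o Some \o inl)
         (v \o inr \o inr \o Some \o inr)) (v (inr (inr None)))).
  apply: (definable_ext _ (definable_reindex (oapp (fun t => match t with
    | inl t => glue inl (inr \o inl) (inr \o inr \o Some \o inr) t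
    | inr t => glue inl (inr \o inr \o Some \o inl) (inr \o inr \o Some \o inr) t
    end) (inr (inr None))) (dth1 j))) => M v.
  set w1 := glue _ _ _; set w0 := glue _ _ _ : _ -> M.
  set w1' := (X in _ <-> th1 j M X _ _); set w0' := (X in _ <-> th1 j M _ X _).
  suff [-> ->] : w1 = w1' /\ w0 = w0' by [].
  by split; apply/funext => -[i|[y|z]].
pose ihj j := cid (ih Y (option (Y + Z)) (fun M a y z => th1 j M
  (glue a y (z \o Some \o inr)) (glue a (z \o Some \o inl) (z \o Some \o inr))
  (z None)) (dR1 j)).
pose J2 j := projT1 (ihj j); pose ihj2 j := cid (projT2 (ihj j)).
have [p] := carrier_inhabited C.
pose z' (y : Y -> C) (z : Z -> C) o :=
  oapp (fun t => match t with inl s => y s | inr s => z s end) p o.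
exists {j : J1 & J2 j}, (fun jj y u z => projT1 (ihj2 (tag jj)) (tagged jj) y
   (u \o lift ord0) (z' (u ord0) z)).
move=> F f0 b a c.
(* Only the [Y] piece varies with [f], so the selected parameters amount to the single index
   [f1]. *)
have [j [f1 f1P]] := th1P p F f0 (fun f => glue (a \o lift ord0) (b f) c) (a ord0).
have [j2 [u uP]] := projT2 (ihj2 j) F f0 b (a \o lift ord0) (z' (b f1) c).
exists (Tagged J2 j2), (vcons f1 u) => f /=.
have -> : (b \o vcons f1 u) \o lift ord0 = b \o u.
  by apply/funext => i /=; rewrite vcons_lift.
rewrite vcons_ord0 -(vcons_eta a); exact: iff_trans (f1P f) (uP f).
Qed.

End FullyVCMinimal.

(** * Counting types over a finite set *)

Lemma sat_signed (L : language) (M : structure L) n (phi : formula L n) s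
    (v : 'I_n -> M) : sat (signed_formula phi s) v <-> (s <-> sat phi v).
Proof.
by case: s => /=; split=> [h|[h1 h2]] //; [apply: h1|move=> /h2].
Qed.

(** With finitely many conditions, the existence of a realization is one first-order property of the
    parameters, so elementarity brings it from the extension back to [C]. *)
Lemma consistent_finite (L : language) (C : structure L) (n m : nat)
    (phi : formula L (n + m)) (K : finType) (e : K -> 'I_m -> C) (t : K -> bool) :
  consistent [set PFormula (signed_formula phi (t i)) (e i) | i in [set: K]] ->
  exists a, forall i, t i <-> sat phi (vcat a (e i)).
Proof.
move=> [N [f [fP [a' a'P]]]].
pose D (M : structure L) (v : K * 'I_m -> M) :=
  exists a, forall i, sat (signed_formula phi (t i)) (vcat a (fun l => v (i, l))).
have dD : definable D.
  apply: (definable_ex_tuple (D := fun M a v => forall i,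
    sat (signed_formula phi (t i)) (vcat a (fun l => v (i, l))))).
  apply: definable_all => i.
  apply: (definable_ext _ (definable_reindex
    (vcat inl (fun l => inr (i, l))) (definable_sat (signed_formula phi (t i))))).
  move=> M v; set u := vcat _ _; set w := (X in _ <-> sat _ X).
  suff -> : u = w by [].
  by rewrite /u /w /vcat; apply/funext => l /=; case: fintype.split.
have [|a aP] := definable_elementary (v := fun il => e il.1 il.2) fP dD.
  by exists a' => i; apply: (a'P (PFormula (signed_formula phi (t i)) (e i))); exists i.
by exists a => i; apply/sat_signed/aP.
Qed.

Lemma card_setT_ord (P : finType) : [set: P] #<= `I_#|P|.
Proof.
have /card_eqPle[le _] := card_esym (@card_II #|P|).
apply: card_le_trans le.
suff -> : [set: P] = enum_val @` [set: 'I_#|P|] by apply: card_image_le.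
by apply/seteqP; split=> // x _; exists (enum_rank x) => //; rewrite enum_rankK.
Qed.

Theorem theorem3p14 (L : language) (T : theory L) (kappa : Type)
  (C : structure L) (hT : complete_theory T) (hC : monster_model T kappa C)
  (hmin : fully_vc_minimal T C) : low_vc_density C.
Proof.
have CT : models C T by case: hC.
move=> n m phi.
(* No fixed parameters are present at the start, so [Z] is [void]. *)
have [|J [theta thetaP]] := @tuple_types L C T CT hmin n 'I_m void
    (fun M a b _ => sat phi (vcat a b)).
  apply: (definable_ext _ (definable_reindex
    (vcat inl (inr \o inl)) (definable_sat phi))) => M v.
  set u := vcat _ _; set w := (X in _ <-> sat _ X); suff -> : u = w by [].
  by rewrite /u /w /vcat; apply/funext => l /=; case: fintype.split.
exists #|J| => k B [b0 Bb0] cardB.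
have [e EB] : exists e : 'I_k -> 'I_m -> C, B = e @` [set: 'I_k].
  have /card_bijP[f [g fK gK]] := cardB.
  have Ik (i : 'I_k) : `I_k i by exact: ltn_ord.
  exists (fun i => set_val (g (SigSub (mem_set (Ik i))))).
  apply/seteqP; split=> [b Bb|_ [i _ <-]]; last exact: set_valP.
  have ib := set_valP (f (SigSub (mem_set Bb))).
  exists (Ordinal ib) => //.
  set y := SigSub _; suff -> : y = f (SigSub (mem_set Bb)) by rewrite fK.
  exact: val_inj.
(* The default index, for when no set is selected. *)
have [f0] : [set: 'I_k] !=set0 by move: Bb0; rewrite EB => -[i]; exists i.
move=> _.
have c : void -> C by [].
(* A formula index and [n] indices into [B] code a candidate set of signed formulas. Every type over
   [B] has such a code, and there are [#|J| * k ^ n] codes. *)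
pose q (ju : J * {ffun 'I_n -> 'I_k}) : set (pformula C n) :=
  [set PFormula (signed_formula phi `[< theta ju.1 b (e \o ju.2) c >]) b | b in B].
have -> : (#|J| * k ^ n)%N = #|{: J * {ffun 'I_n -> 'I_k}}|.
  by rewrite card_prod card_ffun !card_ord.
apply: card_le_trans (card_setT_ord _).
apply: card_le_trans (card_image_le q _).
apply: subset_card_le => p [[t ->] cons].
rewrite EB image_comp in cons.
have [a aP] := consistent_finite (t := t \o e) cons.
have [j [u uP]] := thetaP 'I_k f0 e a c.
exists (j, [ffun i => u i]) => //.
rewrite /q EB !image_comp; congr image; apply/funext => i /=; congr (PFormula (signed_formula phi _) _).
have -> : e \o [ffun i => u i] = e \o u by apply/funext => l /=; rewrite ffunE.
apply/asboolP/idP => [/uP/aP//|/aP/uP//].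
Qed.
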